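(* There is a continuous function $f:(0,\infty)\to(0,\infty)$ with $f(x)\to 0$ as $x\to 0$ such that the following holds. For every $\varepsilon>0$, every instance of the two-group risk assignment problem with $0<\mu_t<N_t$ for $t=1,2$, and every risk assignment for this instance satisfying the $\varepsilon$-approximate fairness conditions (A'), (B') and (C'), at least one of the following is true: 1. ($f(\varepsilon)$-approximate perfect prediction) $\gamma_1\ge 1-f(\varepsilon)$ and $\gamma_2\ge 1-f(\varepsilon)$, where $\gamma_t$ is the average expected score that the risk assignment gives to positive-class members of group $t$; 2. ($f(\varepsilon)$-approximately equal base rates) $|\mu_1/N_1-\mu_2/N_2|\le f(\varepsilon)$.
   Context: **Instance.** An instance consists of a finite set of feature vectors $\sigma$; a number $p_\sigma\in[0,1]$ for each $\sigma$ (the fraction of people with feature vector $\sigma$ who belong to the positive class; this is the same for both groups); and, for each of two groups $t\in\{1,2\}$, a size $N_t>0$ and a probability distribution $(a_{t\sigma})_\sigma$ over feature vectors ($a_{t\sigma}\ge 0$, $\sum_\sigma a_{t\sigma}=1$). Put $n_{t\sigma}=a_{t\sigma}N_t$ (number of group-$t$ people with feature vector $\sigma$, treated as a real number). The size of the positive class of group $t$ is $\mu_t=\sum_\sigma n_{t\sigma}p_\sigma$, and the base rate of group $t$ is $\mu_t/N_t$. **Risk assignment.** A risk assignment consists of a finite set of bins $b$, a score $v_b\in[0,1]$ for each bin, and numbers $X_{\sigma b}\ge 0$ with $\sum_b X_{\sigma b}=1$ for every $\sigma$ ($X_{\sigma b}$ is the fraction of people with feature vector $\sigma$ assigned to bin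 $b$, independently of class and group). **Average scores.** $\gamma_t=\frac{1}{\mu_t}\sum_{\sigma,b}n_{t\sigma}p_\sigma X_{\sigma b}v_b$ is the average expected score of positive-class members of group $t$, and $\beta_t=\frac{1}{N_t-\mu_t}\sum_{\sigma,b}n_{t\sigma}(1-p_\sigma)X_{\sigma b}v_b$ is that of negative-class members of group $t$. **$\varepsilon$-approximate fairness conditions.** - (A') For each $t\in\{1,2\}$ and each bin $b$: $(1-\varepsilon)\,v_b\sum_\sigma n_{t\sigma}X_{\sigma b}\le\sum_\sigma n_{t\sigma}p_\sigma X_{\sigma b}\le(1+\varepsilon)\,v_b\sum_\sigma n_{t\sigma}X_{\sigma b}$. - (B') $(1-\varepsilon)\beta_2\le\beta_1\le(1+\varepsilon)\beta_2$ and $(1-\varepsilon)\beta_1\le\beta_2\le(1+\varepsilon)\beta_1$. - (C') $(1-\varepsilon)\gamma_2\le\gamma_1\le(1+\varepsilon)\gamma_2$ and $(1-\varepsilon)\gamma_1\le\gamma_2\le(1+\varepsilon)\gamma_1$. *)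

(* Defs.v *)
From mathcomp Require Import all_boot all_order all_algebra.
From mathcomp Require Import all_classical all_reals all_analysis.
Import Order.TTheory GRing.Theory Num.Theory.
Import numFieldNormedType.Exports.

Set Implicit Arguments.
Unset Strict Implicit.
Unset Printing Implicit Defensive.

Local Open Scope ring_scope.

Inductive people_group : Set := group1 | group2.

(* [S] is the finite set of feature vectors. *)
Record instance (R : realType) (S : finType) := Instance {
  pos_frac : S -> R;         (* p_sigma, common to both groups *)
  group_size : people_group -> R;   (* N_t, a positive real *)
  dist : people_group -> S -> R;    (* a_{t sigma} *)
  pos_frac_itv : forall s, 0 <= pos_frac s <= 1;
  group_size_gt0 : forall t, 0 < group_size t;
  dist_ge0 : forall t s, 0 <= dist t s;
  dist_sum1 : forall t, \sum_(s : S) dist t s = 1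
}.

(* [B] is the finite set of bins; [share s b] is X_{sigma b}. *)
Record assignment (R : realType) (S B : finType) := Assignment {
  score : B -> R;
  share : S -> B -> R;
  score_itv : forall b, 0 <= score b <= 1;
  share_ge0 : forall s b, 0 <= share s b;
  share_sum1 : forall s, \sum_(b : B) share s b = 1
}.

(* n_{t sigma}, a real number: head counts are not required to be integral. *)
Definition head_count (R : realType) (S : finType) (I : instance R S)
    (t : people_group) (s : S) : R :=
  dist I t s * group_size I t.

(* mu_t: (expected) size of the positive class of group t. *)
Definition pos_size (R : realType) (S : finType) (I : instance R S)
    (t : people_group) : R :=
  \sum_(s : S) head_count I t s * pos_frac I s.

Definition base_rate (R : realType) (S : finType) (I : instance R S)
    (t : people_group) : R :=
  pos_size I t / group_size I t.

(* gamma_t: average expected score of the positive class of group t. *)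
Definition pos_avg (R : realType) (S B : finType) (I : instance R S)
    (A : assignment R S B) (t : people_group) : R :=
  (pos_size I t)^-1 *
  \sum_(s : S) \sum_(b : B)
    head_count I t s * pos_frac I s * share A s b * score A b.

(* beta_t: average expected score of the negative class of group t. *)
Definition neg_avg (R : realType) (S B : finType) (I : instance R S)
    (A : assignment R S B) (t : people_group) : R :=
  (group_size I t - pos_size I t)^-1 *
  \sum_(s : S) \sum_(b : B)
    head_count I t s * (1 - pos_frac I s) * share A s b * score A b.

Definition approx_eq (R : realType) (eps x y : R) : Prop :=
  (1 - eps) * y <= x <= (1 + eps) * y /\
  (1 - eps) * x <= y <= (1 + eps) * x.

Definition approx_calibrated (R : realType) (S B : finType) (eps : R)
    (I : instance R S) (A : assignment R S B) : Prop :=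
  forall (t : people_group) (b : B),
    (1 - eps) * score A b * \sum_(s : S) head_count I t s * share A s b
      <= \sum_(s : S) head_count I t s * pos_frac I s * share A s b
      <= (1 + eps) * score A b * \sum_(s : S) head_count I t s * share A s b.

Definition approx_neg_balanced (R : realType) (S B : finType) (eps : R)
    (I : instance R S) (A : assignment R S B) : Prop :=
  approx_eq eps (neg_avg I A group1) (neg_avg I A group2).

Definition approx_pos_balanced (R : realType) (S B : finType) (eps : R)
    (I : instance R S) (A : assignment R S B) : Prop :=
  approx_eq eps (pos_avg I A group1) (pos_avg I A group2).

(* Main.v *)
(** Write r_t for the base rates. Summing calibration over the bins shows that
    r_t is within eps of the mean score T_t = r_t gamma_t + (1 - r_t) beta_t,
    so r_t ((1 - gamma_t) + beta_t) is within eps of beta_t. The balance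
    conditions allow gamma_2 and beta_2 to be replaced by gamma_1 and beta_1 at
    the cost of another eps, and subtracting the two relations gives
    |r_1 - r_2| ((1 - gamma_1) + beta_1) <= 3 eps. Hence either
    1 - gamma_1 < sqrt eps or |r_1 - r_2| <= 3 sqrt eps. *)

Require Import Defs.
From mathcomp Require Import all_boot all_order all_algebra.
From mathcomp Require Import all_classical all_reals all_analysis.
From mathcomp Require Import ring lra.
Import Order.TTheory GRing.Theory Num.Theory.
Import numFieldNormedType.Exports.

Set Implicit Arguments.
Unset Strict Implicit.
Unset Printing Implicit Defensive.

Local Open Scope classical_set_scope.
Local Open Scope ring_scope.

(** Since [x] and [y] are at most 1, the relative errors [eps * x] and [eps * y] are absolute errors
    of at most [eps]. *)
Lemma approx_eq_dist (R : realType) (eps x y : R) :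
  0 <= eps -> x <= 1 -> y <= 1 -> approx_eq eps x y -> `|x - y| <= eps.
Proof.
move=> e0 x1 y1 [/andP[_ hx] /andP[_ hy]].
have ex : eps * x <= eps by rewrite ler_piMr.
have ey : eps * y <= eps by rewrite ler_piMr.
by rewrite ler_norml; apply/andP; split; lra.
Qed.

Lemma base_rate_gap (R : realFieldType) (eps r1 r2 g1 g2 b1 b2 : R) :
  0 <= r2 <= 1 ->
  `|r1 - (r1 * g1 + (1 - r1) * b1)| <= eps ->
  `|r2 - (r2 * g2 + (1 - r2) * b2)| <= eps ->
  `|b1 - b2| <= eps -> `|g1 - g2| <= eps ->
  `|r1 - r2| * `|1 - g1 + b1| <= 3 * eps.
Proof.
move=> /andP[r0 r1'] h1 h2 hb hg.
(* An exact identity: the difference of the two calibration defects plus a combination of the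
   balance gaps. The latter has weights [r2] and [1 - r2], so both gaps together cost a single
   [eps]. *)
have -> : `|r1 - r2| * `|1 - g1 + b1| =
    `|(r1 - (r1 * g1 + (1 - r1) * b1)) - (r2 - (r2 * g2 + (1 - r2) * b2))
      + (r2 * (g1 - g2) + (1 - r2) * (b1 - b2))|.
  by rewrite -normrM; congr `|_|; ring.
have s0 : 0 <= 1 - r2 by rewrite subr_ge0.
have hr : `|r2 * (g1 - g2) + (1 - r2) * (b1 - b2)| <= eps.
  have -> : eps = r2 * eps + (1 - r2) * eps by ring.
  apply: (le_trans (ler_normD _ _)).
  by rewrite !normrM (ger0_norm r0) (ger0_norm s0); apply: lerD; exact: ler_wpM2l.
have -> : 3 * eps = eps + eps + eps by ring.
apply: (le_trans (ler_normD _ _)); apply: lerD => //.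
by apply: (le_trans (ler_normB _ _)); apply: lerD.
Qed.

Section Scores.
Variables (R : realType) (S B : finType) (A : assignment R S B).

(** Scores lie in [0, 1] and the shares of each feature vector sum to 1. Taking for [w] the positive
    or the negative head counts puts both class averages in [0, 1]. *)
Lemma weighted_score_itv (w : S -> R) : (forall s, 0 <= w s) ->
  0 <= \sum_s \sum_b w s * share A s b * score A b <= \sum_s w s.
Proof.
move=> w0; apply/andP; split.
  apply: sumr_ge0 => s _; apply: sumr_ge0 => b _.
  have /andP[v0 _] := score_itv A b.
  by rewrite !mulr_ge0 // share_ge0.
apply: ler_sum => s _; rewrite -[leRHS]mulr1 -(share_sum1 A s) mulr_sumr.
apply: ler_sum => b _; have /andP[_ v1] := score_itv A b.
by rewrite ler_piMr // mulr_ge0 // share_ge0.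
Qed.

Variables (I : instance R S) (t : people_group).

Lemma head_count_ge0 (s : S) : 0 <= head_count I t s.
Proof. by rewrite mulr_ge0 ?dist_ge0 // ltW // group_size_gt0. Qed.

Lemma sum_head_count : \sum_s head_count I t s = group_size I t.
Proof. by rewrite -mulr_suml dist_sum1 mul1r. Qed.

Lemma neg_sizeE :
  \sum_s head_count I t s * (1 - pos_frac I s) = group_size I t - pos_size I t.
Proof.
rewrite -sum_head_count -sumrB; apply: eq_bigr => s _.
by rewrite mulrBr mulr1.
Qed.

Lemma pos_avg_itv : 0 < pos_size I t -> 0 <= pos_avg I A t <= 1.
Proof.
move=> m0; have w0 s : 0 <= head_count I t s * pos_frac I s.
  by have /andP[p0 _] := pos_frac_itv I s; rewrite mulr_ge0 // head_count_ge0.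
have /andP[h0 h1] := weighted_score_itv w0.
apply/andP; split; first by rewrite mulr_ge0 // invr_ge0 ltW.
by rewrite /pos_avg ler_pdivrMl // mulr1.
Qed.

Lemma neg_avg_itv : pos_size I t < group_size I t -> 0 <= neg_avg I A t <= 1.
Proof.
rewrite -subr_gt0 => m0.
have w0 s : 0 <= head_count I t s * (1 - pos_frac I s).
  have /andP[_ p1] := pos_frac_itv I s.
  by rewrite mulr_ge0 ?head_count_ge0 // subr_ge0.
have /andP[h0 h1] := weighted_score_itv w0.
apply/andP; split; first by rewrite mulr_ge0 // invr_ge0 ltW.
by rewrite /neg_avg ler_pdivrMl // mulr1 -neg_sizeE.
Qed.

(** Double counting of the group's total score, by bin and by class. The bin form matches
    calibration, the class form the balance conditions. *)
Lemma total_scoreE : 0 < pos_size I t < group_size I t ->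
  \sum_b score A b * \sum_s head_count I t s * share A s b =
  pos_size I t * pos_avg I A t + (group_size I t - pos_size I t) * neg_avg I A t.
Proof.
move=> /andP[m0 mN]; rewrite /pos_avg /neg_avg.
rewrite !mulVKf ?gt_eqF ?subr_gt0 // -big_split /=.
under eq_bigr do rewrite mulr_sumr.
rewrite exchange_big /=; apply: eq_bigr => s _.
by rewrite -big_split /=; apply: eq_bigr => b _; ring.
Qed.

Lemma sum_pos_share :
  \sum_b \sum_s head_count I t s * pos_frac I s * share A s b = pos_size I t.
Proof.
rewrite exchange_big; apply: eq_bigr => s _.
by rewrite -mulr_sumr share_sum1 mulr1.
Qed.

Lemma base_rate_itv : 0 < pos_size I t < group_size I t ->
  0 <= base_rate I t <= 1.
Proof.
move=> /andP[m0 mN]; have N0 := group_size_gt0 I t.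
by rewrite /base_rate ler_pdivrMr // mul1r (ltW mN) divr_ge0 // ltW.
Qed.

Lemma base_rate_calibrated (eps : R) : 0 <= eps ->
  0 < pos_size I t < group_size I t -> approx_calibrated eps I A ->
  `|base_rate I t - (base_rate I t * pos_avg I A t
                     + (1 - base_rate I t) * neg_avg I A t)| <= eps.
Proof.
move=> e0 hm cal; have N0 := group_size_gt0 I t.
have /andP[m0 mN] := hm.
have /andP[g0 g1] := pos_avg_itv m0; have /andP[b0 b1] := neg_avg_itv mN.
(* [T] is the mean score of the group. As a convex combination of the class averages it is at most
   1, which turns the relative calibration error into an absolute one. *)
set T := (X in _ - X).
have TE : T = (\sum_b score A b * \sum_s head_count I t s * share A s b)
              / group_size I t.
  by rewrite total_scoreE // /T /base_rate; field; rewrite gt_eqF.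
have T1 : T <= 1.
  have /andP[r0 r1] := base_rate_itv hm.
  rewrite /T; set r := base_rate I t in r0 r1 *.
  rewrite [leRHS](_ : 1 = r * 1 + (1 - r) * 1); last by ring.
  by apply: lerD; rewrite ler_wpM2l // subr_ge0.
have eT : eps * T <= eps by rewrite ler_piMr.
(* After clearing the group size, both bounds are the calibration inequalities summed over the
   bins. *)
have lo : (1 - eps) * T <= base_rate I t.
  rewrite TE /base_rate mulrA ler_pM2r ?invr_gt0 // -sum_pos_share mulr_sumr.
  by apply: ler_sum => b _; rewrite mulrA; case/andP: (cal t b).
have hi : base_rate I t <= (1 + eps) * T.
  rewrite TE /base_rate mulrA ler_pM2r ?invr_gt0 // -sum_pos_share mulr_sumr.
  by apply: ler_sum => b _; rewrite mulrA; case/andP: (cal t b).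
by rewrite ler_norml; apply/andP; split; lra.
Qed.

End Scores.

Theorem theorem1p2 (R : realType) :
  exists f : R -> R,
    [/\ {within [set x : R | 0 < x], continuous f},
        (forall x : R, 0 < x -> 0 < f x),
        f x @[x --> 0^'+] --> (0 : R)
      & forall (eps : R) (S B : finType)
               (I : instance R S) (A : assignment R S B),
          0 < eps ->
          (forall t : people_group, 0 < pos_size I t < group_size I t) ->
          approx_calibrated eps I A ->
          approx_neg_balanced eps I A ->
          approx_pos_balanced eps I A ->
          (1 - f eps <= pos_avg I A group1 /\
           1 - f eps <= pos_avg I A group2) \/
          `|base_rate I group1 - base_rate I group2| <= f eps].
Proof.
(* The term [3 * Num.sqrt x] bounds the base-rate gap; the extra [x] pays for passing from [pos_avg]
   of [group1] to that of [group2]. *)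
pose f (x : R) := 3 * Num.sqrt x + x.
have fc : continuous f.
  move=> x; apply: cvgD; last exact: cvg_id.
  by apply: cvgM; [exact: cvg_cst|exact: sqrt_continuous].
exists f; split.
- exact: continuous_subspaceT.
- by move=> x x0; rewrite /f addr_gt0 // mulr_gt0 // sqrtr_gt0.
- have f0 : f 0 = 0 by rewrite /f sqrtr0 mulr0 addr0.
  by rewrite -[X in _ --> X]f0; apply: cvg_at_right_filter; exact: fc.
move=> eps S B I A e0 hm cal negb posb.
have mg t : 0 <= pos_avg I A t <= 1.
  by apply: pos_avg_itv; case/andP: (hm t).
have mb t : 0 <= neg_avg I A t <= 1.
  by apply: neg_avg_itv; case/andP: (hm t).
have /andP[_ g1] := mg group1; have /andP[_ g2] := mg group2.
have /andP[b10 b1] := mb group1; have /andP[_ b2] := mb group2.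
have e0' := ltW e0.
have hg := approx_eq_dist e0' g1 g2 posb.
have hb := approx_eq_dist e0' b1 b2 negb.
have gap := base_rate_gap (base_rate_itv (hm group2))
  (base_rate_calibrated e0' (hm group1) cal)
  (base_rate_calibrated e0' (hm group2) cal) hb hg.
have s0 : 0 < Num.sqrt eps by rewrite sqrtr_gt0.
have sE : eps = Num.sqrt eps * Num.sqrt eps by rewrite -expr2 sqr_sqrtr.
rewrite /f; case: (ltP (1 - pos_avg I A group1) (Num.sqrt eps)) => hs.
  by left; move: hg; rewrite ler_norml => /andP[? ?]; split; lra.
right; apply: (@le_trans _ _ (3 * Num.sqrt eps)); last by rewrite lerDl.
(* Multiplying by [Num.sqrt eps] makes the right side [3 * eps], as in [gap]. It remains that
   [Num.sqrt eps] is at most [1 - pos_avg + neg_avg] for [group1], which follows from [hs] and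
   [b10]. *)
rewrite -(ler_pM2r s0) -mulrA -sE; apply: le_trans gap.
apply: ler_wpM2l => //; apply: le_trans (ler_norm _); lra.
Qed.
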